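(* Let $X$ be a separable Banach space and $p\in[1,+\infty)$. Then $E(X,0)\sim_B\mathbb R^{\mathbb N}/c_0$, and $E(X,p)$ is not Borel comparable with $\mathbb R^{\mathbb N}/c_0$, i.e. neither $E(X,p)\le_B\mathbb R^{\mathbb N}/c_0$ nor $\mathbb R^{\mathbb N}/c_0\le_B E(X,p)$.
   Context: For a separable Banach space $X$, $E(X,0)$ is the equivalence relation on $X^{\mathbb N}$ given by $(x,y)\in E(X,0)\iff\lim_n\|x(n)-y(n)\|_X=0$, and for $p\in[1,\infty)$, $E(X,p)$ is given by $(x,y)\in E(X,p)\iff\sum_n\|x(n)-y(n)\|_X^p<+\infty$. $\mathbb R^{\mathbb N}/c_0$ is the relation on $\mathbb R^{\mathbb N}$ with $x\sim y\iff x-y\in c_0$ (i.e. $x(n)-y(n)\to0$). $E\le_B F$ means there is a Borel map $\theta$ between the underlying Polish spaces with $(x,y)\in E\iff(\theta(x),\theta(y))\in F$; $E\sim_B F$ means $E\le_B F$ and $F\le_B E$.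
   Formalization: The Banach space X is assumed to be nonzero: for X = {0} the relations E(X,0) and E(X,p) have a single class, so ℝ^ℕ/c₀ is not Borel reducible to E(X,0) and E(X,p) is Borel reducible to ℝ^ℕ/c₀, and the statement fails. *)

(* Defs.v *)
From HB Require Import structures.
From mathcomp Require Import all_boot all_order all_algebra.
From mathcomp Require Import all_classical all_reals all_analysis.

Set Implicit Arguments.
Unset Strict Implicit.
Unset Printing Implicit Defensive.

Import Order.TTheory GRing.Theory Num.Theory.
Import numFieldNormedType.Exports.

Local Open Scope classical_set_scope.
Local Open Scope ring_scope.

Definition separable (T : topologicalType) : Prop :=
  exists2 S : set T, countable S & dense S.

Definition borel_fun (T U : topologicalType) (f : T -> U) : Prop :=
  forall B : set U, <<s @open U >> B -> <<s @open T >> (f @^-1` B).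

Definition borel_reducible (T U : topologicalType)
    (E : T -> T -> Prop) (F : U -> U -> Prop) : Prop :=
  exists2 theta : T -> U, borel_fun theta &
    forall x y : T, E x y <-> F (theta x) (theta y).

Definition borel_bireducible (T U : topologicalType)
    (E : T -> T -> Prop) (F : U -> U -> Prop) : Prop :=
  borel_reducible E F /\ borel_reducible F E.

(* Sequence spaces carry the product topology, hence the type {ptws nat -> _};
   its elements are plain functions. *)

Definition E_zero (R : realType) (X : normedModType R)
    (x y : {ptws nat -> X}) : Prop :=
  (fun n => `|x n - y n|) @ \oo --> (0 : R).

Definition E_pow (R : realType) (X : normedModType R) (p : R)
    (x y : {ptws nat -> X}) : Prop :=
  (\sum_(0 <= n <oo) (`|x n - y n| `^ p)%:E < +oo)%E.

Definition c0 (R : realType) : set (nat -> R) := [set u | u @ \oo --> (0 : R)].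

Definition RN_mod_c0 (R : realType) (x y : {ptws nat -> R}) : Prop :=
  c0 (fun n => x n - y n).

Arguments E_zero {R} X x y.
Arguments E_pow {R} X p x y.
Arguments RN_mod_c0 R x y : clear implicits.

(* Main.v *)
Require Import Defs.
From mathcomp Require Import all_boot all_order all_algebra.
From mathcomp Require Import all_classical all_reals all_analysis.
From mathcomp Require Import ring lra zify.
Import Order.TTheory GRing.Theory Num.Theory.
Import numFieldNormedType.Exports.
Local Open Scope classical_set_scope.
Local Open Scope ring_scope.

Set Implicit Arguments.
Unset Strict Implicit.
Unset Printing Implicit Defensive.

(** [E(X,0) <= R^N/c_0]: at scale [u = 2^-m], the bumps
    [max 0 (min (min_(j<k) |x - q_j| - u) (3u - |x - q_k|))] built on a dense
    sequence [q] are 1-Lipschitz, at most [2u], nonzero at [x] for finitely many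
    [k] only, and one of them separates by [u] two points at distance at least
    [5u].  Over all scales and [k] they give a uniform embedding of [X] into
    [c_0].

    Both non-reductions start from a Borel [theta] precomposed with a map of the
    Cantor space [2^N] that turns the [i]-th bit into a weight depending on a
    color of [i], each color being used infinitely often.  On a comeager set,
    invariant under finite modifications, all coordinates of [theta] are
    continuous.  Flipping finitely many bits changes [theta] by an element of
    the target ideal, and by Baire category the tails of this change are
    uniformly small on a cylinder.  A fusion then yields a generic [x0],
    positions [n_t] of prescribed colors and a partition of the coordinates into
    consecutive blocks such that flipping bit [n_t] only affects block [t], up
    to [2^-t], independently of the other flips.  Let [c_t] be the size of the
    effect on block [t].

    For target [c_0] and source weights [1/(t+1)] at [n_t]: flipping all bits
    [n_t] changes the class, so [c_t] does not tend to [0]; but flipping the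
    bits of a summable subsequence along which [c_t] stays away from [0]
    preserves the class.

    For target [l_p] and source [c_0] with weight [1/(l+1)] on color [l]:
    flipping all the bits [n_t] of color [l] changes the class, so the sum of
    [c_t] over color [l] is infinite and a finite part of it exceeds [1];
    flipping these finite parts for all [l] preserves the class, but the sum of
    [c_t] diverges. *)

Lemma dependent_choice_nat (T : Type) (P : nat -> T -> Prop)
    (Q : nat -> T -> T -> Prop) (x0 : T) :
  P 0%N x0 -> (forall n x, P n x -> exists2 y, P n.+1 y & Q n x y) ->
  exists f : nat -> T, [/\ f 0%N = x0, forall n, P n (f n)
    & forall n, Q n (f n) (f n.+1)].
Proof.
move=> P0 step.
(* Choice needs a total relation, so the invariant becomes a premise and states violating it receive
   a dummy successor. *)
have /choice[g gP] (nx : nat * T) :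
    exists y, P nx.1 nx.2 -> P nx.1.+1 y /\ Q nx.1 nx.2 y.
  have [Pnx|nPnx] := pselect (P nx.1 nx.2); last by exists nx.2.
  by have [y Py Qy] := step _ _ Pnx; exists y.
pose f := fix f n := if n is m.+1 then g (m, f m) else x0.
have Pf n : P n (f n) by elim: n => //= n /(gP (n, _)) [].
by exists f; split => // n; have [] := gP (n, f n) (Pf n).
Qed.

(** * Baire category in the Cantor space *)

(** [agree n x] is the basic clopen neighbourhood of [x]; the topology of the Cantor space is only
    handled through these cylinders. *)
Definition agree (n : nat) (x y : nat -> bool) : Prop :=
  forall i, (i < n)%N -> x i = y i.

Definition flip (x a : nat -> bool) : nat -> bool := fun i => x i (+) a i.

Lemma agree_sym n x y : agree n x y -> agree n y x.
Proof. by move=> xy i /xy. Qed.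

Lemma agree_trans n x y z : agree n x y -> agree n y z -> agree n x z.
Proof. by move=> xy yz i ni; rewrite xy// yz. Qed.

Lemma agree_leq m n x y : (m <= n)%N -> agree n x y -> agree m x y.
Proof. by move=> mn xy i im; apply: xy; exact: leq_trans mn. Qed.

Lemma agree_flip n x y a b :
  agree n x y -> agree n a b -> agree n (flip x a) (flip y b).
Proof. by move=> xy ab i ni; rewrite /flip xy// ab. Qed.

Lemma flipK a : involutive (flip^~ a).
Proof. by move=> x; apply/funext => i; rewrite /flip addbK. Qed.

Lemma flipA x a b : flip (flip x a) b = flip x (flip a b).
Proof. by apply/funext => i; rewrite /flip addbA. Qed.

(** Every cylinder contains a cylinder lying inside [U], that is, [U] contains a dense open set
    without having to be open itself. *)
Definition dense_interior (U : set (nat -> bool)) : Prop :=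
  forall x n, exists y m, [/\ (n <= m)%N, agree n x y
    & forall z, agree m y z -> U z].

Definition comeager (G : set (nat -> bool)) : Prop :=
  exists2 D : nat -> set (nat -> bool), forall i, dense_interior (D i)
    & \bigcap_i D i `<=` G.

Lemma agree_limit (x : nat -> nat -> bool) (N : nat -> nat) :
  (forall t, t <= N t)%N -> (forall t, N t <= N t.+1)%N ->
  (forall t, agree (N t) (x t) (x t.+1)) ->
  exists y, forall t, agree (N t) (x t) y.
Proof.
move=> leN N_incr xS.
have xD t u : agree (N t) (x t) (x (t + u)%N).
  elim: u => [|u IH]; first by rewrite addn0.
  rewrite addnS; apply: agree_trans IH _; apply: agree_leq (xS _).
  elim: u => [|u IH]; first by rewrite addn0.
  by rewrite addnS; exact: leq_trans (N_incr _).
(* Since [i.+1 <= N i.+1], bit [i] never changes from stage [i.+1] on. *)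
exists (fun i => x i.+1 i) => t i ti.
have [it|it] := leqP t i.+1.
  by have := xD t (i.+1 - t)%N i ti; rewrite subnKC.
have := xD i.+1 (t - i.+1)%N i (leN _).
by rewrite subnKC// 1?ltnW// => ->.
Qed.

Lemma comeager_dense G x n : comeager G -> exists2 y, agree n x y & G y.
Proof.
move=> [D Dd DG].
have [||f [f0 Pf Qf]] := @dependent_choice_nat ((nat -> bool) * nat)
  (fun t s => (t <= s.2)%N) (fun t s s' => [/\ (s.2 <= s'.2)%N,
    agree s.2 s.1 s'.1 & forall z, agree s'.2 s'.1 z -> D t z]) (x, n).
- by [].
(* Asking for depth [m.+1] rather than [m] makes the cylinders shrink to a single point. *)
- move=> t [y m] /= tm; have [z [k [mk yz Dz]]] := Dd t y m.+1.
  exists (z, k) => /=; first by apply: leq_trans mk.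
  split => //; first exact: ltnW.
  exact: agree_leq yz.
have [|||z zP] := @agree_limit (fst \o f) (snd \o f).
- exact: Pf.
- by move=> t; case: (Qf t).
- by move=> t; case: (Qf t).
exists z; first by have := zP 0%N; rewrite /= f0.
by apply: DG => t _; case: (Qf t) => _ _; apply; exact: zP.
Qed.

Lemma comeager_bigcap (T : countType) (G : T -> set (nat -> bool)) :
  (forall i, comeager (G i)) -> comeager (\bigcap_i G i).
Proof.
move=> cG.
have /choice[D DP] i : exists D : nat -> set (nat -> bool),
    (forall j, dense_interior (D j)) /\ \bigcap_j D j `<=` G i.
  by have [D] := cG i; exists D.
exists (fun k => if unpickle k is Some ij then D ij.1 ij.2 else setT) => [k|].
  case: unpickle => [ij|]; first exact: (DP ij.1).1.
  by move=> x n; exists x, n.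
move=> x Dx i _; apply: (DP i).2 => j _.
by have := Dx (pickle (i, j)) I; rewrite pickleK.
Qed.

Lemma comeagerI F G : comeager F -> comeager G -> comeager (F `&` G).
Proof.
move=> cF cG; have [|D Dd DFG] :=
  @comeager_bigcap bool (fun b => if b then F else G).
  by case.
exists D => // x /DFG FGx; split; [exact: (FGx true)|exact: (FGx false)].
Qed.

Lemma comeager_dense_interior U : dense_interior U -> comeager U.
Proof. by move=> dU; exists (fun=> U) => // x /(_ 0%N I). Qed.

Lemma comeagerT : comeager setT.
Proof. by apply: comeager_dense_interior => x n; exists x, n. Qed.

Lemma comeager_flip a G : comeager G -> comeager [set x | G (flip x a)].
Proof.
move=> [D Dd DG]; exists (fun i => [set x | D i (flip x a)]) => [i x n|x Dx].
  have [y [m [nm xy Dy]]] := Dd i (flip x a) n.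
  exists (flip y a), m; split => //.
    by rewrite -(flipK a x); exact: agree_flip.
  by move=> z yz; apply: Dy; rewrite -(flipK a y); exact: agree_flip.
by apply: DG => i _; exact: Dx.
Qed.

(** Relative clopenness on a comeager set is equivalent to the Baire property, and this form is
    visibly symmetric under complement. *)
Definition baire_property (A : set (nat -> bool)) : Prop :=
  exists2 G, comeager G & forall x, G x -> exists n,
    forall y, G y -> agree n x y -> (A x <-> A y).

Lemma baire_propertyC A : baire_property A -> baire_property (~` A).
Proof.
move=> [G cG GA]; exists G => // x /GA[n nP]; exists n => y Gy xy.
by rewrite /setC /= (nP _ Gy xy).
Qed.

(** A set that is relatively open in [G] becomes clopen once its boundary is removed: [W] collects
    the points having a cylinder on which membership in [B] is decided within [G]. *)
Lemma baire_property_open G B : comeager G ->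
  (forall x, G x -> B x -> exists n, forall y, G y -> agree n x y -> B y) ->
  baire_property B.
Proof.
move=> cG oB.
pose W := [set x | exists n, (forall y, G y -> agree n x y -> B y) \/
                             (forall y, G y -> agree n x y -> ~ B y)].
have dW : dense_interior W.
  move=> x n.
  have [[y [Gy xy By]]|noB] := pselect (exists y, [/\ G y, agree n x y & B y]).
    have [m mP] := oB y Gy By.
    exists y, (maxn n m); split => [|//|z yz]; first exact: leq_maxl.
    exists m; left => w Gw zw; apply: mP => //; apply: agree_trans zw.
    by apply: agree_leq yz; exact: leq_maxr.
  exists x, n; split => // z xz; exists n; right => w Gw zw Bw.
  by apply: noB; exists w; split => //; exact: agree_trans zw.
exists (G `&` W); first exact/comeagerI/comeager_dense_interior.
move=> x [Gx [n [nB|nB]]]; exists n => y [Gy _] xy.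
  by split => _; apply: nB.
by split => [/nB|/nB]; [case|move/(_ Gy xy)].
Qed.

Lemma baire_property_bigcup (A : nat -> set (nat -> bool)) :
  (forall i, baire_property (A i)) -> baire_property (\bigcup_i A i).
Proof.
move=> bA.
have /choice[G GP] i : exists G, comeager G /\ forall x, G x -> exists n,
    forall y, G y -> agree n x y -> (A i x <-> A i y).
  by have [G] := bA i; exists G.
apply: (@baire_property_open (\bigcap_i G i)).
  by apply: comeager_bigcap => i; exact: (GP i).1.
move=> x Gx [i _ Aix]; have [n nP] := (GP i).2 x (Gx i I).
by exists n => y Gy xy; exists i => //; apply/(nP y (Gy i I) xy).
Qed.

(** The sets whose preimage has the Baire property form a sigma-algebra, and continuity of [iota]
    puts the open sets in it. *)
Lemma borel_baire_property (T : topologicalType) (iota : (nat -> bool) -> T) :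
  (forall U x, open U -> U (iota x) ->
    exists n, forall y, agree n x y -> U (iota y)) ->
  forall B, <<s @open T >> B -> baire_property (iota @^-1` B).
Proof.
move=> iota_cont; apply: smallest_sub.
  split=> [|A bA|A bA].
  - rewrite preimage_set0; exists setT; first exact: comeagerT.
    by move=> x _; exists 0%N.
  - by rewrite setTD; exact: baire_propertyC.
  - by rewrite preimage_bigcup; exact: baire_property_bigcup.
move=> U oU; apply: (baire_property_open comeagerT).
by move=> x _ /(iota_cont _ _ oU)[n nP]; exists n => y _; exact: nP.
Qed.

Lemma coordinatewise_cylinder_continuous (R : realType) (Y : normedModType R)
    (f : nat -> bool -> Y) (U : set {ptws nat -> Y}) x :
  open U -> U (fun i => f i (x i)) ->
  exists n, forall y, agree n x y -> U (fun i => f i (y i)).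
Proof.
(* The cylinders around [x] serve as a filter; coordinate [t] of the image is constant on the
   cylinder of depth [t.+1]. *)
move=> oU Ux; pose F := filter_from setT (fun n => agree n x).
have FF : Filter F.
  apply: filter_from_filter; first by exists 0%N.
  move=> i j _ _; exists (maxn i j) => // y xy.
  by split; apply: agree_leq xy; rewrite ?leq_maxl ?leq_maxr.
pose g y : {ptws nat -> Y} := fun i => f i (y i).
have : g y @[y --> F] --> g x.
  apply/pointwise_cvgP => t A /nbhs_singleton At.
  by exists t.+1 => // y xy; rewrite /= /g -xy.
by move=> /(_ U (open_nbhs_nbhs (conj oU Ux)))[n _ nP]; exists n.
Qed.

Lemma open_coordinate_ball (R : realType) (Y : normedModType R) j (q : Y) (e : R) :
  open [set u : {ptws nat -> Y} | `|u j - q| < e].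
Proof.
rewrite openE => u /= uj.
have /pointwise_cvgP/(_ j) uu : {ptws, nbhs (u : {ptws nat -> Y}) --> u} by [].
suff : \forall y \near u j, `|y - q| < e by exact: uu.
have : ball q e (u j) by rewrite -ball_normE /= distrC.
move=> quj; have : nbhs (u j) (ball q e).
  by apply: open_nbhs_nbhs; split => //; exact: ball_open.
by apply: filterS => y; rewrite -ball_normE /= distrC.
Qed.

Lemma borel_fun_coordinate_baire (R : realType) (X Y : normedModType R)
    (f : nat -> bool -> X) (theta : {ptws nat -> X} -> {ptws nat -> Y})
    j (q : Y) (e : R) : borel_fun theta ->
  baire_property [set x | `|theta (fun i => f i (x i)) j - q| < e].
Proof.
move=> btheta.
apply: (@borel_baire_property {ptws nat -> X} (fun x i => f i (x i)) _
  [set u | `|theta u j - q| < e]) => [U x|].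
  exact: coordinatewise_cylinder_continuous.
apply: (btheta [set u | `|u j - q| < e]); apply: sub_gen_smallest.
exact: open_coordinate_ball.
Qed.

(** * Fusion *)

Definition supported (m : nat) (b : nat -> bool) : Prop :=
  forall i, (m <= i)%N -> b i = false.

(** Finitely supported flips are thereby indexed by the countable type [seq bool], so comeager sets
    can be intersected over all of them. *)
Lemma supportedE m b : supported m b -> b = nth false (mkseq b m).
Proof.
move=> bm; apply/funext => i; have [im|mi] := ltnP i m.
  by rewrite nth_mkseq.
by rewrite nth_default ?size_mkseq// bm.
Qed.

Lemma flip_nth_ex (s t : seq bool) :
  exists u, flip (nth false s) (nth false t) = nth false u.
Proof.
exists (mkseq (flip (nth false s) (nth false t)) (maxn (size s) (size t))).
apply: supportedE => i; rewrite geq_max => /andP[si ti].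
by rewrite /flip !nth_default.
Qed.

Lemma separable_dense_seq (R : realType) (Y : normedModType R) :
  separable Y ->
  exists q : nat -> Y, forall y e, 0 < e -> exists i, `|y - q i| < e.
Proof.
move=> [S cS dS].
have ballS (y : Y) (e : R) : 0 < e -> exists2 z, S z & `|y - z| < e.
  move=> e0; have [||z [yz Sz]] := dS (ball y e).
  - by exists y; exact: ballxx.
  - exact: ball_open.
  by exists z => //; move: yz; rewrite -ball_normE.
move: cS => /pfcard_geP[S0|[f]].
  by have [z] := ballS 0 1 ltr01; rewrite S0.
exists (f : nat -> Y) => y e /(ballS y)[z Sz yz].
by have [i _ iz] := @surj _ _ _ _ f z Sz; exists i; rewrite iz.
Qed.

(** [P b y M] is a requirement on the cylinder of [y] of depth [M], relative to a flip [b]; it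
    survives shrinking and can be met inside any cylinder. *)
Definition hereditary_dense
    (P : (nat -> bool) -> (nat -> bool) -> nat -> Prop) : Prop :=
  (forall b x y N M, (N <= M)%N -> agree N x y -> P b x N -> P b y M) /\
  (forall b m x N, supported m b ->
    exists y M, [/\ (N <= M)%N, agree N x y & P b y M]).

(** Only finitely many flips live below [m]. The induction frees one more bit by requiring [P] for
    [b] and for [b] with bit [m] flipped at once. *)
Lemma hereditary_dense_uniform P m x N : hereditary_dense P ->
  exists y M, [/\ (N <= M)%N, agree N x y & forall b, supported m b -> P b y M].
Proof.
elim: m P x N => [|m IH] P x N [hP dP].
  have s0 : supported 0 (fun=> false) by [].
  have [y [M [NM xy Py]]] := dP _ 0%N x N s0.
  exists y, M; split => // b b0.
  by have -> : b = (fun=> false) by apply/funext => i; rewrite b0.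
pose em i := i == m.
have [|y [M [NM xy PM]]] := IH (fun b x N => P b x N /\ P (flip b em) x N) x N.
  split=> [b y z K L KL yz [P1 P2]|b k y K bk].
    by split; [exact: hP P1|exact: hP P2].
  have [z [L [KL yz Pz]]] := dP b k y K bk.
  have [|w [L' [LL' zw Pw]]] := dP (flip b em) (maxn k m.+1) z L.
    move=> i; rewrite geq_max => /andP[ki mi].
    by rewrite /flip bk// /em gtn_eqF.
  exists w, L'; split; first exact: leq_trans LL'.
    by apply: agree_trans yz _; exact: agree_leq zw.
  by split => //; exact: hP Pz.
exists y, M; split => // b bm.
have [bm1|/negP bm1] := boolP (b m).
  rewrite -(flipK em b); apply: (PM _ _).2 => i.
  rewrite leq_eqVlt /flip /em => /predU1P[<-|mi].
    by rewrite bm1 eqxx.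
  by rewrite bm// gtn_eqF.
apply: (PM _ _).1 => i; rewrite leq_eqVlt => /predU1P[<-|]; last exact: bm.
exact/negbTE/negP.
Qed.

(* [D k n d] measures the terms of [d] with indices in [[k, n)]. *)
Record gauge (R : realType) (D : nat -> nat -> (nat -> R) -> R) (C : R) := {
  gauge_const : 1 <= C;
  gauge_triangle : forall k n d d1 d2,
    (forall j, 0 <= d j) -> (forall j, 0 <= d1 j) -> (forall j, 0 <= d2 j) ->
    (forall j, (j < n)%N -> d j <= d1 j + d2 j) ->
    D k n d <= C * (D k n d1 + D k n d2);
  gauge_mono : forall k l n d, (forall j, 0 <= d j) -> (k <= l)%N ->
    D l n d <= D k n d;
  gauge_small : forall k n e, 0 < e -> exists2 r, 0 < r & forall d,
    (forall j, 0 <= d j) -> (forall j, (j < n)%N -> d j <= r) -> D k n d <= e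
}.

Definition dist (R : realType) (Y : normedModType R) (u v : nat -> Y) : nat -> R :=
  fun j => `|u j - v j|.

Lemma dist_ge0 (R : realType) (Y : normedModType R) (u v : nat -> Y) j :
  0 <= dist u v j.
Proof. exact: normr_ge0. Qed.
#[local] Hint Resolve dist_ge0 : core.

Lemma distC (R : realType) (Y : normedModType R) (u v : nat -> Y) :
  dist u v = dist v u.
Proof. by apply/funext => j; rewrite /dist distrC. Qed.

Section fusion.
Variables (R : realType) (Y : normedModType R).
Variable theta : (nat -> bool) -> nat -> Y.
Hypothesis Ysep : separable Y.
Hypothesis theta_baire : forall j q e,
  baire_property [set x | `|theta x j - q| < e].

(** Countably many small balls around a dense sequence decide each coordinate. Intersecting their
    comeager witnesses gives continuity, and intersecting all finite flips of the result gives
    invariance. *)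
Lemma generic_continuity : exists G, [/\ comeager G,
  forall m b x, supported m b -> G x -> G (flip x b) &
  forall x j e, G x -> 0 < e -> exists n, forall y, G y -> agree n x y ->
    `|theta x j - theta y j| < e].
Proof.
have [q qd] := separable_dense_seq Ysep.
pose A (i : nat * nat * nat) :=
  [set x | `|theta x i.1.1 - q i.1.2| < i.2.+1%:R^-1].
have /choice[F FP] i : exists F, comeager F /\ forall x, F x -> exists n,
    forall y, F y -> agree n x y -> (A i x <-> A i y).
  by have [F] := theta_baire i.1.1 (q i.1.2) i.2.+1%:R^-1; exists F.
pose F' := \bigcap_i F i.
pose G := \bigcap_(s : seq bool) [set x | F' (flip x (nth false s))].
have GF : G `<=` F'.
  move=> x /(_ [::] I) /=; congr F'; apply/funext => i.
  by rewrite /flip nth_nil addbF.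
exists G; split.
- apply: comeager_bigcap => s; apply: comeager_flip.
  by apply: comeager_bigcap => i; exact: (FP i).1.
- move=> m b x /supportedE -> Gx s _ /=.
  rewrite flipA; have [u ->] := flip_nth_ex (mkseq b m) s.
  exact: Gx.
- move=> x j e Gx e0.
  have e20 : 0 < e / 2 by rewrite divr_gt0.
  pose r := Num.bound (e / 2)^-1.
  have rlt : r.+1%:R^-1 < e / 2.
    rewrite invf_plt ?posrE// (lt_trans (archi_boundP _))//.
      by rewrite invr_ge0 ltW.
    by rewrite ltr_nat.
  have [i xi] := qd (theta x j) r.+1%:R^-1 ltac:(by rewrite invr_gt0).
  have [n nP] := (FP (j, i, r)).2 x (GF _ Gx _ I).
  exists n => y Gy xy.
  have /(nP y (GF _ Gy _ I) xy) : A (j, i, r) x by [].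
  rewrite /A /= distrC => yi.
  rewrite -(subrKA (q i)) (le_lt_trans (ler_normD _ _))//.
  by rewrite (splitr e) ltrD// ?(lt_trans yi)// (lt_trans xi).
Qed.

Variables (D : nat -> nat -> (nat -> R) -> R) (C : R).
Hypothesis Dgauge : gauge D C.
Hypothesis theta_tail : forall m b x e, supported m b -> 0 < e ->
  exists k, forall n, D k n (dist (theta x) (theta (flip x b))) <= e.

Variables (G : set (nat -> bool)).
Hypothesis Gcomeager : comeager G.
Hypothesis Gflip : forall m b x, supported m b -> G x -> G (flip x b).
Hypothesis Gcont : forall x j e, G x -> 0 < e -> exists n,
  forall y, G y -> agree n x y -> `|theta x j - theta y j| < e.

Lemma gauge_const_gt0 : 0 < C.
Proof. exact: lt_le_trans (gauge_const Dgauge). Qed.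

Lemma uniform_continuity_finite x n e : G x -> 0 < e ->
  exists m, forall y, G y -> agree m x y ->
    forall j, (j < n)%N -> `|theta x j - theta y j| < e.
Proof.
move=> Gx e0.
have /choice[m mP] j : exists m, forall y, G y -> agree m x y ->
    `|theta x j - theta y j| < e by exact: Gcont.
exists (\max_(j < n) m j) => y Gy xy j jn; apply: mP => //.
by apply: agree_leq xy; exact: (@leq_bigmax _ _ (Ordinal jn)).
Qed.

(* The tail hypothesis only bounds a tail depending on the point; by the Baire
   category theorem the bound is uniform on the generic points of a cylinder. *)
Lemma tail_uniform m b e x N : supported m b -> 0 < e ->
  exists y M, [/\ (N <= M)%N, agree N x y & forall z, G z -> agree M y z ->
    forall n, D M n (dist (theta z) (theta (flip z b))) <= e].
Proof.
move=> bm e0; apply: contrapT => nogood.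
pose d z := dist (theta z) (theta (flip z b)).
have bad y M : (N <= M)%N -> agree N x y ->
    exists z n, [/\ G z, agree M y z & e < D M n (d z)].
  move=> NM xy; apply: contrapT => nobad; apply: nogood; exists y, M.
  split => // z Gz yz n; rewrite leNgt; apply/negP => De.
  by apply: nobad; exists z, n.
have C0 := gauge_const_gt0.
(* Chosen so that [e = C * (e' + e')], matching the quasi-triangle inequality of the gauge. *)
pose e' := e / (2 * C).
have e'0 : 0 < e' by rewrite divr_gt0// mulr_gt0.
(* If no cylinder works, every [U k] has dense interior, so some generic point lies in all of them;
   this contradicts [theta_tail] at that point. *)
pose U k := [set y | G y -> agree N x y -> exists n, e' < D k n (d y)].
have dU k : dense_interior (U k).
  move=> z M; pose M' := maxn (maxn M k) N.
  have [xz|nxz] := pselect (agree N x z); last first.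
    exists z, M'; split => [||w zw _ xw] //; first by rewrite /M'; lia.
    exfalso; apply: nxz; apply: agree_trans xw _; apply: agree_sym.
    by apply: agree_leq zw; rewrite /M'; lia.
  have [||y [n [Gy zy De]]] := bad z M'; [by rewrite /M'; lia|by []|].
  have [r r0 rP] := gauge_small Dgauge k n e'0.
  have r20 : 0 < r / 2 by rewrite divr_gt0.
  have [l1 l1P] := uniform_continuity_finite n Gy r20.
  have [l2 l2P] := uniform_continuity_finite n (Gflip bm Gy) r20.
  exists y, (maxn M (maxn l1 l2)); split => [||w yw Gw xw].
  - by rewrite leq_maxl.
  - by apply: agree_leq zy; rewrite /M'; lia.
  exists n; rewrite ltNge; apply/negP => Dw.
  (* On the finite window the change at [w] differs little from the change at [y], by continuity at
     [y] and at [flip y b]. *)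
  have : D k n (d y) <= C * (D k n (d w) + D k n
      (fun j => `|theta y j - theta w j| +
                `|theta (flip y b) j - theta (flip w b) j|)).
    apply: (gauge_triangle Dgauge) => j; rewrite /d //.
    move=> _; rewrite /dist (le_trans (ler_distD (theta w j) _ _))//.
    rewrite addrCA lerD2l (le_trans (ler_distD (theta (flip w b) j) _ _))//.
    by rewrite lerD2l distrC.
  apply/negP; rewrite -ltNge.
  have De' : e < D k n (d y).
    apply: (lt_le_trans De); apply: (gauge_mono Dgauge); last by rewrite /M'; lia.
    by move=> j; rewrite /d.
  apply: le_lt_trans De'.
  have -> : e = C * (e' + e').
    by rewrite /e'; field; exact: lt0r_neq0.
  rewrite ler_pM2l// lerD//; apply: rP => j; first by rewrite addr_ge0.
  move=> jn; rewrite (splitr r) lerD//; apply: ltW.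
    by apply: l1P => //; apply: agree_leq yw; lia.
  apply: l2P => //; first exact: Gflip bm Gw.
  by apply: agree_flip => //; apply: agree_leq yw; lia.
have [y xy [Gy Uy]] : exists2 y, agree N x y & (G `&` \bigcap_k U k) y.
  apply: comeager_dense; apply: comeagerI => //.
  by apply: comeager_bigcap => k; exact: comeager_dense_interior.
have [k kP] := theta_tail y bm e'0.
by have [n] := Uy k I Gy xy; rewrite ltNge kP.
Qed.

(** The cylinder is sought around [flip x b], where a generic [g] provides continuity, and is then
    carried back by flipping with [b] again. *)
Lemma oscillation_uniform U n b m e x N : dense_interior U -> supported m b ->
  0 < e -> exists y M, [/\ (N <= M)%N, agree N x y,
    forall z, agree M (flip y b) z -> U z &
    forall z w, G z -> G w -> agree M (flip y b) z -> agree M (flip y b) w ->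
      forall j, (j < n)%N -> dist (theta z) (theta w) j <= e].
Proof.
move=> dU bm e0.
have [y [M [NM xy Uy]]] := dU (flip x b) N.
have [g yg Gg] := comeager_dense y M Gcomeager.
have e20 : 0 < e / 2 by rewrite divr_gt0.
have [l lP] := uniform_continuity_finite n Gg e20.
exists (flip g b), (maxn M l); rewrite flipK; split.
- by rewrite leq_max NM.
- rewrite -(flipK b x); apply: agree_flip => //.
  by apply: agree_trans xy _; exact: agree_leq yg.
- move=> z gz; apply: Uy; apply: agree_trans yg _.
  by apply: agree_leq gz; exact: leq_maxl.
- move=> z w Gz Gw gz gw j jn.
  rewrite /dist (le_trans (ler_distD (theta g j) _ _))// (splitr e) distrC.
  by rewrite lerD// ltW// lP//; exact: (agree_leq (leq_maxr M l)).
Qed.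

Variables (color tau : nat -> nat) (eta : nat -> R).
Hypothesis color_inf : forall c N, exists2 n, (N <= n)%N & color n = c.
Hypothesis eta_gt0 : forall t, 0 < eta t.

(* Bits below [freed] may still be flipped, those between [freed] and [depth]
   are fixed by [center], and [cut] is the start of the next block. *)
Record stage :=
  Stage { center : nat -> bool; freed : nat; cut : nat; depth : nat }.

(** The clause on [b] makes flips of earlier bits negligible in all later blocks. *)
Definition stage_ok (t : nat) (s : stage) : Prop :=
  [/\ (t <= depth s)%N, (freed s <= depth s)%N, (cut s <= depth s)%N &
    forall b, supported (freed s) b -> forall z, G z ->
    agree (depth s) (center s) z ->
    forall n, D (cut s) n (dist (theta z) (theta (flip z b))) <= eta t].

(** The new position is [(freed s').-1]. The clause on [U t] keeps all flipped limits generic, and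
    the last clause makes later flips negligible in the current block. *)
Definition stage_step (U : nat -> set (nat -> bool)) (t : nat) (s s' : stage) :=
  [/\ [/\ (depth s <= depth s')%N, agree (depth s) (center s) (center s'),
    (depth s < freed s')%N, color (freed s').-1 = tau t & (cut s < cut s')%N],
    forall b, supported (freed s') b -> forall z,
      agree (depth s') (flip (center s') b) z -> U t z &
    forall b, supported (freed s') b -> forall z w, G z -> G w ->
      agree (depth s') (flip (center s') b) z ->
      agree (depth s') (flip (center s') b) w ->
      D (cut s) (cut s') (dist (theta z) (theta w)) <= eta t].

Lemma stage_step_ex U : (forall t, dense_interior (U t)) ->
  forall t s, stage_ok t s ->
  exists2 s', stage_ok t.+1 s' & stage_step U t s s'.
Proof.
move=> dU t [x m k N] [/= tN mN kN tail].
have [n Nn colorn] := color_inf (tau t) N.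
(* First refinement: tails for all flips of bits up to [n]. The depth [N1] so obtained becomes the
   end of the current block. *)
have [|x1 [N1 [nN1 xx1 tail1]]] := @hereditary_dense_uniform (fun b y M =>
    forall z, G z -> agree M y z ->
    forall i, D M i (dist (theta z) (theta (flip z b))) <= eta t.+1) n.+1 x n.+1.
  split=> [b y z K L KL yz P w Gw zw i|b l y K bl]; last exact: tail_uniform bl _.
  apply: le_trans (P w Gw _ i); first exact: (gauge_mono Dgauge).
  by apply: agree_trans yz _; exact: agree_leq zw.
(* Second refinement: now that the block is finite, the bits beyond a new depth are made irrelevant
   to it. *)
have [r r0 rP] := gauge_small Dgauge k N1 (eta_gt0 t).
have [|x2 [N2 [N12 xx2 osc]]] := @hereditary_dense_uniform (fun b y M =>
    (forall z, agree M (flip y b) z -> U t z) /\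
    forall z w, G z -> G w -> agree M (flip y b) z -> agree M (flip y b) w ->
      forall j, (j < N1)%N -> dist (theta z) (theta w) j <= r) n.+1 x1 N1.
  split=> [b y z K L KL yz [P1 P2]|b l y K bl].
    have mono w : agree L (flip z b) w -> agree K (flip y b) w.
      move=> zw; apply: agree_trans (agree_leq KL zw).
      exact: agree_flip.
    by split=> [w /mono/P1//|w v Gw Gv /mono zw /mono zv]; exact: P2.
  have [z [M [? ? ? ?]]] := oscillation_uniform N1 y K (dU t) bl r0.
  by exists z, M; split.
exists (Stage x2 n.+1 N1 N2).
  split => /=; [lia|lia|lia|move=> b bn z Gz x2z i].
  apply: tail1 => //; apply: agree_trans xx2 _; exact: agree_leq x2z.
split => /=; [split => //; try lia| |].
- by apply: agree_trans (agree_leq _ xx1) (agree_leq _ xx2); lia.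
- by move=> b bn; exact: (osc b bn).1.
- move=> b bn z w Gz Gw xz xw; apply: rP => // j jN1.
  exact: (osc b bn).2.
Qed.

(** In block [t], flips at earlier positions are negligible by the tail clause and flips at later
    positions by the oscillation clause, so only the bit [n t] matters. Each costs [eta t], and one
    quasi-triangle inequality combines them. *)
Lemma fusion : exists x0 (n k : nat -> nat), [/\
  forall t, (n t < n t.+1)%N, forall t, color (n t) = tau t,
  k 0%N = 0%N, forall t, (k t < k t.+1)%N &
  forall a : nat -> bool, (forall i, a i -> exists t, i = n t) -> forall t,
    D (k t) (k t.+1) (dist (theta (flip x0 a))
      (theta (flip x0 (fun i => a i && (i == n t))))) <= C * (eta t + eta t)].
Proof.
have [U dU UG] := Gcomeager.
have [||s [s0 sok sstep]] := @dependent_choice_nat stage stage_ok (stage_step U)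
    (Stage (fun=> false) 0 0 0).
- split => //= b b0 z _ _ n.
  have -> : flip z b = z by apply/funext => i; rewrite /flip b0// addbF.
  have [r r0 rP] := gauge_small Dgauge 0 n (eta_gt0 0%N).
  apply: rP => // j _.
  by rewrite /dist subrr normr0 ltW.
- exact: stage_step_ex.
pose N t := depth (s t); pose m t := freed (s t); pose x t := center (s t).
have mN t : (m t <= N t)%N by case: (sok t).
have Nm t : (N t < m t.+1)%N by case: (sstep t) => -[].
have NS t : (N t <= N t.+1)%N by case: (sstep t) => -[].
have [||x0 x0P] := @agree_limit x N _ NS.
- by move=> t; case: (sok t).
- by move=> t; case: (sstep t) => -[].
have N_mono : {homo N : t u / (t <= u)%N}.
  by apply: homo_leq => // t u v; exact: leq_trans.
have m_mono : {homo m : t u / (t <= u)%N}.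
  apply: homo_leq => // [t u v|t]; first exact: leq_trans.
  exact: ltnW (leq_ltn_trans (mN t) (Nm t)).
pose n t := (m t.+1).-1.
have mn t : m t.+1 = (n t).+1 by rewrite /n prednK// (leq_trans _ (Nm t)).
have Nn t : (N t <= n t)%N by rewrite -ltnS -mn.
exists x0, n, (fun t => cut (s t)); split.
- by move=> t; have := Nn t.+1; have := mN t.+1; rewrite mn; lia.
- by move=> t; case: (sstep t) => -[].
- by rewrite s0.
- by move=> t; case: (sstep t) => -[].
pose on_n (a : nat -> bool) := forall i, a i -> exists t, i = n t.
pose low (a : nat -> bool) t : nat -> bool := fun i => a i && (i < m t)%N.
have lowm a t : supported (m t) (low a t).
  by move=> i mi; rewrite /low ltnNge mi andbF.
(* Hence a flip at the positions [n u] touches no bit between [m t] and [N t], and up to depth [N t]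
   it coincides with its [low] part. *)
have n_cases t u : (n u < m t)%N || (N t <= n u)%N.
  have [ut|tu] := ltnP u t; first by rewrite -mn m_mono.
  by rewrite (leq_trans (N_mono _ _ tu)) ?orbT.
have low_agree a t : on_n a -> agree (N t) (low a t) a.
  move=> an i iN; rewrite /low; case: (boolP (a i)) => //= /an[u iu].
  by have := n_cases t u; rewrite -iu [X in _ || X]leqNgt iN orbF.
have near a t : on_n a -> agree (N t) (flip (x t) (low a t)) (flip x0 a).
  by move=> an; apply: agree_flip; [exact: x0P|exact: low_agree].
have inG a : on_n a -> G (flip x0 a).
  move=> an; apply: UG => t _; have [_ Ut _] := sstep t.
  by apply: Ut (near a t.+1 an); exact: lowm.
move=> a an t.
(* The intermediate point drops the flips before [n t]; dropping those after [n t] as well leaves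
   [at_t]. *)
pose high i := a i && (m t <= i)%N; pose at_t i := a i && (i == n t).
have highn : on_n high by move=> i /andP[/an].
have at_tn : on_n at_t by move=> i /andP[/an].
have low_high : low high t.+1 = at_t.
  apply/funext => i; rewrite /low /high /at_t; case: (boolP (a i)) => //= /an[u ->].
  rewrite mn ltnS; have [->|nut] := eqVneq (n u) (n t).
    by rewrite leqnn andbT (leq_trans (mN t) (Nn t)).
  apply/negbTE/negP => /andP[mtu nu].
  have : (n u < n t)%N by rewrite ltn_neqAle nut.
  have [ut|tu] := ltnP u t.
    by have := m_mono _ _ ut; rewrite mn; lia.
  have := m_mono _ _ (tu : (t.+1 <= u.+1)%N); rewrite !mn; lia.
have low_at : low at_t t.+1 = at_t.
  apply/funext => i; rewrite /low /at_t mn.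
  by case: (eqVneq i (n t)) => [->|]; rewrite ?ltnS ?leqnn ?andbT ?andbF.
have split_a : flip x0 a = flip (flip x0 high) (low a t).
  rewrite flipA; congr flip; apply/funext => i.
  by rewrite /flip /high /low leqNgt; case: (a i); case: (i < m t)%N.
apply: le_trans (_ : C * (D (cut (s t)) (cut (s t.+1))
    (dist (theta (flip x0 high)) (theta (flip x0 a))) +
  D (cut (s t)) (cut (s t.+1))
    (dist (theta (flip x0 high)) (theta (flip x0 at_t)))) <= _).
  apply: (gauge_triangle Dgauge) => // j _.
  by rewrite /dist (le_trans (ler_distD (theta (flip x0 high) j) _ _))// distrC.
rewrite ler_pM2l ?gauge_const_gt0// lerD//.
  rewrite split_a; have [_ _ _ tail] := sok t.
  apply: tail; [exact: lowm|exact: inG|].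
  have := near high t highn; have -> : low high t = fun=> false.
    apply/funext => i; rewrite /low /high leqNgt -andbA andNb andbF.
    by [].
  have -> // : flip (x t) (fun=> false) = x t.
  by apply/funext => i; rewrite /flip addbF.
have [_ _ osc] := sstep t.
apply: (osc at_t); [|exact: inG|exact: inG| |].
- by rewrite -low_at; exact: lowm.
- by rewrite -low_high; exact: near.
- by rewrite -{1}low_at; exact: near.
Qed.

End fusion.

Section block_estimates.
Variables (R : realType) (Y : normedModType R).
Variable theta : (nat -> bool) -> nat -> Y.
Hypothesis Ysep : separable Y.
Hypothesis theta_baire : forall j q e,
  baire_property [set x | `|theta x j - q| < e].
Variables (D : nat -> nat -> (nat -> R) -> R) (C : R).
Hypothesis Dgauge : gauge D C.
Hypothesis theta_tail : forall m b x e, supported m b -> 0 < e ->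
  exists k, forall n, D k n (dist (theta x) (theta (flip x b))) <= e.
Variables (color tau : nat -> nat) (eta : nat -> R).
Hypothesis color_inf : forall c N, exists2 n, (N <= n)%N & color n = c.
Hypothesis eta_gt0 : forall t, 0 < eta t.

(* Flipping [x0] at the position [n t] affects the image only in the [t]-th
   block of coordinates, up to a negligible error. *)
Lemma block_estimates : exists x0 (n k : nat -> nat) (c : nat -> R), [/\
  forall t, (n t < n t.+1)%N, forall t, color (n t) = tau t,
  k 0%N = 0%N, forall t, (k t < k t.+1)%N &
  forall a : nat -> bool, (forall i, a i -> exists t, i = n t) -> forall t,
    let Dt := D (k t) (k t.+1) (dist (theta x0) (theta (flip x0 a))) in
    Dt <= C * ((if a (n t) then c t else 0) + 2 * C * eta t) /\
    (a (n t) -> c t <= C * (Dt + 2 * C * eta t))].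
Proof.
have [G [cG Gflip Gcont]] := generic_continuity Ysep theta_baire.
have [x0 [n [k [n_lt n_color k0 k_lt blockP]]]] :=
  fusion Dgauge theta_tail cG Gflip Gcont tau color_inf eta_gt0.
pose one t := theta (flip x0 (fun i => i == n t)).
have twice t : C * (eta t + eta t) = 2 * C * eta t by ring.
have C1 := gauge_const Dgauge; have C0 := gauge_const_gt0 Dgauge.
(* [c t] is the effect on block [t] of flipping the single bit [n t]. *)
exists x0, n, k, (fun t => D (k t) (k t.+1) (dist (theta x0) (one t))).
split => // a an t /=; have := blockP a an t; rewrite {}twice.
have [ant|/negbTE ant] := boolP (a (n t)).
  have -> : (fun i => a i && (i == n t)) = (fun i => i == n t).
    by apply/funext => i; case: eqVneq => [->|]; rewrite ?ant ?andbF.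
  rewrite -/(one t) => close; split => [|_].
  - apply: le_trans (gauge_triangle Dgauge (k t) (n := k t.+1) _ _ _
      (_ : forall j, _ -> _ <= dist (theta x0) (one t) j +
                dist (theta (flip x0 a)) (one t) j)) _ => //.
    + by move=> j _; rewrite /dist [X in _ <= _ + X]distrC; exact: ler_distD.
    + by rewrite ler_pM2l// lerD2l.
  - apply: le_trans (gauge_triangle Dgauge (k t) (n := k t.+1) _ _ _
      (_ : forall j, _ -> _ <= dist (theta x0) (theta (flip x0 a)) j +
                dist (theta (flip x0 a)) (one t) j)) _ => //.
    + by move=> j _; exact: ler_distD.
    + by rewrite ler_pM2l// lerD2l.
have -> : (fun i => a i && (i == n t)) = (fun=> false).
  by apply/funext => i; case: eqVneq => [->|]; rewrite ?ant ?andbF.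
have -> : flip x0 (fun=> false) = x0 by apply/funext => i; rewrite /flip addbF.
rewrite distC add0r => close; split => //.
(* The extra factor [C >= 1] only serves to give both cases the same bound. *)
by rewrite (le_trans close)// ler_peMl// mulr_ge0 ?mulr_ge0 ?ltW.
Qed.

End block_estimates.

(** * Gauges for [c_0] and [l_p] *)

Section sup_gauge.
Variable R : realType.

Definition sup_gauge (k n : nat) (d : nat -> R) : R :=
  \big[Num.max/0]_(k <= j < n) d j.

Lemma sup_gauge_le k n d e : 0 <= e ->
  (forall j, (k <= j < n)%N -> d j <= e) -> sup_gauge k n d <= e.
Proof.
move=> e0 de; rewrite /sup_gauge big_nat_cond; apply: bigmax_le => // j.
by rewrite andbT => /de.
Qed.

Lemma le_sup_gauge k n d j : (k <= j < n)%N -> d j <= sup_gauge k n d.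
Proof. by move=> kjn; apply: le_bigmax_seq => //; rewrite mem_index_iota. Qed.

Lemma sup_gauge_ge0 k n d : 0 <= sup_gauge k n d.
Proof. exact: bigmax_ge_id. Qed.

Lemma sup_gaugeP : gauge sup_gauge 1.
Proof.
split=> // [k n d d1 d2 d0 d10 d20 dd|k l n d d0 kl|k n e e0].
- rewrite mul1r; apply: sup_gauge_le; first by rewrite addr_ge0 ?sup_gauge_ge0.
  move=> j /[dup] kjn /andP[_ jn]; rewrite (le_trans (dd j jn))// lerD//;
  exact: le_sup_gauge.
- apply: sup_gauge_le; first exact: sup_gauge_ge0.
  by move=> j /andP[lj jn]; apply: le_sup_gauge; rewrite (leq_trans kl).
- exists e => // d d0 de; apply: sup_gauge_le; first exact: ltW.
  by move=> j /andP[_ /de].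
Qed.

Lemma sup_gauge_tail (u v : nat -> R) : RN_mod_c0 R u v ->
  forall e, 0 < e -> exists k, forall n, sup_gauge k n (dist u v) <= e.
Proof.
move=> /cvgrPdist_le uv e e0; have [k _ kP] := uv e e0.
exists k => n; apply: sup_gauge_le; first exact: ltW.
by move=> j /andP[kj _]; have := kP j kj; rewrite /= sub0r normrN.
Qed.

(** Block starts satisfy [t <= k t], so there is a last block starting at or before [j]. *)
Lemma block_cover (k : nat -> nat) : k 0%N = 0%N -> (forall t, (k t < k t.+1)%N) ->
  forall T j, (k T <= j)%N -> exists2 t, (T <= t)%N & (k t <= j < k t.+1)%N.
Proof.
move=> k0 k_lt T j kTj.
have kge t : (t <= k t)%N by elim: t => // t IH; exact: leq_ltn_trans (k_lt t).
pose P t := (T <= t)%N && (k t <= j)%N.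
have exP : exists t, P t by exists T; rewrite /P leqnn.
have ubP t : P t -> (t <= j)%N by move=> /andP[_]; exact: leq_trans (kge t).
case: (ex_maxnP exP ubP) => m /andP[Tm kmj] mmax; exists m => //; rewrite kmj ltnNge/=.
apply/negP => kSj; have := mmax m.+1; rewrite /P kSj (leq_trans Tm)// ltnn.
by move/(_ isT).
Qed.

Lemma sup_gauge_blocks (k : nat -> nat) (u v : nat -> R) :
  k 0%N = 0%N -> (forall t, (k t < k t.+1)%N) ->
  (forall e, 0 < e -> exists T, forall t, (T <= t)%N ->
    sup_gauge (k t) (k t.+1) (dist u v) <= e) ->
  RN_mod_c0 R u v.
Proof.
move=> k0 k_lt small; apply/cvgrPdist_le => e /small[T TP].
exists (k T) => // j /(block_cover k0 k_lt)[t /TP ? jt].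
rewrite /= sub0r normrN.
exact: le_trans (le_sup_gauge (dist u v) jt) _.
Qed.

End sup_gauge.

Section pow_gauge.
Variables (R : realType) (p : R).
Hypothesis p_gt0 : 0 < p.

Definition pow_gauge (k n : nat) (d : nat -> R) : R :=
  \sum_(k <= j < n) d j `^ p.

(** Bound the sum by twice the maximum. The gauge omits the [p]-th root, which is why it obeys the
    triangle inequality only up to a constant. *)
Lemma powR_quasi_triangle (x y z : R) : 0 <= x -> 0 <= y -> 0 <= z ->
  x <= y + z -> x `^ p <= 2 `^ p * (y `^ p + z `^ p).
Proof.
move=> x0 y0 z0 xyz.
have m0 : 0 <= Num.max y z by rewrite le_max y0.
apply: (@le_trans _ _ ((2 * Num.max y z) `^ p)).
  apply: (ge0_ler_powR (ltW p_gt0)); rewrite ?nnegrE ?mulr_ge0//.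
  by rewrite (le_trans xyz)// mulr_natl mulr2n lerD// le_max lexx ?orbT.
rewrite powRM// ler_wpM2l ?powR_ge0//.
by case: (leP y z) => _; rewrite ?lerDl ?lerDr ?powR_ge0.
Qed.

Lemma sum_nat_mono (F : nat -> R) k l n m : (forall j, 0 <= F j) ->
  (k <= l)%N -> (n <= m)%N -> \sum_(l <= j < n) F j <= \sum_(k <= j < m) F j.
Proof.
move=> F0 kl nm; have [nl|ln] := leqP n l.
  by rewrite big_geq// sumr_ge0.
rewrite (big_cat_nat kl) ?(big_cat_nat (ltnW ln) nm) ?(leq_trans (ltnW ln))//=.
by rewrite addrCA lerDl addr_ge0// sumr_ge0.
Qed.

Lemma pow_gaugeP : gauge pow_gauge (2 `^ p).
Proof.
split=> [|k n d d1 d2 d0 d10 d20 dd|k l n d d0 kl|k n e e0].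
- by have := ler_powR (ler1n R 2) (ltW p_gt0); rewrite powRr0.
- rewrite -big_split mulr_sumr /pow_gauge !big_nat; apply: ler_sum => j /andP[_ jn].
  by apply: powR_quasi_triangle => //; exact: dd.
- by apply: sum_nat_mono => // j; exact: powR_ge0.
- have r0 : 0 <= e / n.+1%:R by rewrite divr_ge0 ?ltW.
  (* At most [n] terms contribute [e / n.+1] each; the successor covers [n = 0]. *)
  exists ((e / n.+1%:R) `^ p^-1); first by apply: powR_gt0; rewrite divr_gt0.
  move=> d d0 dr; apply: (@le_trans _ _ (\sum_(0 <= j < n) (e / n.+1%:R))).
    apply: (le_trans (sum_nat_mono _ (leq0n k) (leqnn n))) => [j|].
      exact: powR_ge0.
    rewrite !big_nat; apply: ler_sum => j /andP[_ /dr djr].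
    have -> : e / n.+1%:R = ((e / n.+1%:R) `^ p^-1) `^ p.
      by rewrite -powRrM mulVf ?powRr1// lt0r_neq0.
    by apply: (ge0_ler_powR (ltW p_gt0)); rewrite ?nnegrE ?powR_ge0.
  rewrite sumr_const_nat subn0 -[leLHS]mulr_natr mulrAC ler_pdivrMr// ler_pM2l//.
  by rewrite ler_nat.
Qed.

Lemma E_powP (X : normedModType R) (x y : {ptws nat -> X}) :
  E_pow X p x y <-> exists M, forall n, pow_gauge 0 n (dist x y) <= M.
Proof.
pose F n := `|x n - y n| `^ p.
have F0 n : (0 <= (F n)%:E)%E by rewrite lee_fin powR_ge0.
have sumE n : (\sum_(0 <= i < n) (F i)%:E)%E = (pow_gauge 0 n (dist x y))%:E.
  by rewrite sumEFin.
split=> [fin|[M MP]].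
  pose S := (\sum_(0 <= n <oo) (F n)%:E)%E.
  have Sfin : S \is a fin_num.
    by rewrite ge0_fin_numE//; exact: nneseries_ge0.
  exists (fine S) => n; rewrite -lee_fin fineK// -sumE.
  exact: nneseries_lim_ge.
apply: (@le_lt_trans _ _ M%:E); last exact: ltry.
apply: lime_le; first exact: is_cvg_nneseries.
by apply: nearW => n; rewrite sumE lee_fin.
Qed.

Lemma pow_gauge_tail (X : normedModType R) (x y : {ptws nat -> X}) :
  E_pow X p x y ->
  forall e, 0 < e -> exists k, forall n, pow_gauge k n (dist x y) <= e.
Proof.
move=> /E_powP[M MP] e e0.
pose S := [set pow_gauge 0 n (dist x y) | n in setT].
have supS : has_sup S.
  split; first by exists (pow_gauge 0 0 (dist x y)), 0%N.
  by exists M => _ [n _ <-].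
have [_ [k _ <-] kP] := sup_adherent e0 supS.
exists k => n; have [nk|kn] := leqP n k.
  by rewrite /pow_gauge big_geq// ltW.
have : pow_gauge 0 n (dist x y) <= sup S.
  by apply: sup_upper_bound => //; exists n.
rewrite {1}/pow_gauge (big_cat_nat (leq0n k) (ltnW kn))//= -!/(pow_gauge _ _ _).
by move: kP; lra.
Qed.

Lemma pow_gauge_blocks (k : nat -> nat) (d : nat -> R) T :
  k 0%N = 0%N -> (forall t, (k t < k t.+1)%N) ->
  \sum_(0 <= t < T) pow_gauge (k t) (k t.+1) d = pow_gauge 0 (k T) d.
Proof.
move=> k0 k_lt; elim: T => [|T IH]; first by rewrite k0 /pow_gauge !big_geq.
rewrite big_nat_recr//= IH /pow_gauge.
by rewrite [RHS](big_cat_nat (leq0n (k T)) (ltnW (k_lt T))).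
Qed.

End pow_gauge.

(** * Non-reducibility *)

(** The 2-adic valuation takes each value [c] at all numbers [2 ^ c] times an odd number, hence
    infinitely often. *)
Definition color (n : nat) : nat := logn 2 n.+1.

Lemma color_infinite c N : exists2 n, (N <= n)%N & color n = c.
Proof.
have e0 : (0 < 2 ^ c)%N by rewrite expn_gt0.
have pos : (0 < 2 ^ c * N.*2.+1)%N by rewrite muln_gt0 e0.
exists (2 ^ c * N.*2.+1).-1.
  have : (1 * N.*2.+1 <= 2 ^ c * N.*2.+1)%N by rewrite leq_mul2r e0 orbT.
  lia.
rewrite /color prednK// lognM// pfactorK//.
by rewrite logn_coprime ?addn0// coprime2n /= odd_double.
Qed.

Lemma half_pow_lt (R : realType) (e : R) : 0 < e ->
  exists T, forall t, (T <= t)%N -> 2^-1 ^+ t < e.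
Proof.
move=> e0; exists (Num.bound e^-1) => t Tt.
rewrite exprVn invf_plt ?posrE ?exprn_gt0//.
apply: (lt_le_trans (archi_boundP _)); first by rewrite invr_ge0 ltW.
by rewrite -natrX ler_nat (leq_trans Tt)// ltnW// ltn_expl.
Qed.

Lemma half_pow_sum_le (R : realType) n : \sum_(0 <= t < n) 2^-1 ^+ t <= 2 :> R.
Proof.
suff -> : \sum_(0 <= t < n) 2^-1 ^+ t = 2 - 2 * 2^-1 ^+ n :> R.
  by rewrite gerBl mulr_ge0// exprn_ge0.
elim: n => [|n IH]; first by rewrite big_geq// expr0; lra.
by rewrite big_nat_recr//= IH exprS; field.
Qed.

Lemma increasing_ge (n : nat -> nat) : (forall t, (n t < n t.+1)%N) ->
  forall t, (t <= n t)%N.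
Proof. by move=> n_lt; elim=> // t IH; exact: leq_ltn_trans (n_lt t). Qed.

Lemma increasing_mono (n : nat -> nat) : (forall t, (n t < n t.+1)%N) ->
  {homo n : t u / (t < u)%N}.
Proof. by move=> n_lt; apply: homo_ltn => // t u v; exact: ltn_trans. Qed.

Lemma sum_subsequence_le (R : realType) (n : nat -> nat) (F : nat -> R) T :
  (forall t, (n t < n t.+1)%N) -> (forall i, 0 <= F i) ->
  \sum_(0 <= t < T) F (n t) <= \sum_(0 <= i < n T) F i.
Proof.
move=> n_lt F0; elim: T => [|T IH]; first by rewrite big_geq// sumr_ge0.
rewrite big_nat_recr//= (@big_cat_nat _ _ _ (n T) 0 (n T.+1))//= ?(ltnW (n_lt T))//.
by rewrite lerD// big_ltn// lerDl sumr_ge0.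
Qed.

Lemma harmonic_unbounded (R : realType) (M : R) :
  exists T, M < \sum_(0 <= t < T) t.+1%:R^-1.
Proof.
apply: contrapT => bnd; apply: (@dvg_harmonic R).
apply: nondecreasing_is_cvgn.
  by apply/nondecreasing_seqP => n; rewrite /series /= big_nat_recr//= lerDl.
exists M => _ [n _ <-]; rewrite leNgt; apply/negP => Mn.
by apply: bnd; exists n.
Qed.

Section flips.
Variables (R : realType) (X : normedModType R) (w : nat -> X).

Definition flip_seq (x : nat -> bool) : {ptws nat -> X} :=
  fun i => if x i then w i else 0.

Lemma dist_flip_seq x a :
  dist (flip_seq x) (flip_seq (flip x a)) = fun i => if a i then `|w i| else 0.
Proof.
apply/funext => i; rewrite /dist /flip_seq /flip.
by case: (x i) (a i) => [] [] /=; rewrite ?subr0 ?sub0r ?subrr ?normrN ?normr0.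
Qed.

End flips.

Lemma E_pow_not_reducible (R : realType) (X : normedModType R) (v : X) (p : R) :
  v != 0 -> 0 < p -> ~ borel_reducible (E_pow X p) (RN_mod_c0 R).
Proof.
move=> v0 p0 [th bth thP].
have nv0 : 0 < `|v| by rewrite normr_gt0.
pose h i : R := (color i).+1%:R^-1.
have h0 i : 0 <= h i by rewrite invr_ge0.
(* The [p]-th power of the norm of [w i] is [h i], so flipping a set of bits preserves the class
   exactly when [h] is summable on it. *)
pose w i : X := (h i `^ p^-1 / `|v|) *: v.
have wE i : `|w i| `^ p = h i.
  rewrite normrZ ger0_norm ?divr_ge0 ?powR_ge0// divfK ?lt0r_neq0//.
  by rewrite -powRrM mulVf ?powRr1// lt0r_neq0.
pose iota := flip_seq w; pose theta x := th (iota x).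
pose F (a : nat -> bool) i : R := if a i then h i else 0.
have F0 a i : 0 <= F a i by rewrite /F; case: ifP.
have EF x a : E_pow X p (iota x) (iota (flip x a)) <->
    exists M, forall n, \sum_(0 <= i < n) F a i <= M.
  rewrite E_powP dist_flip_seq.
  have sumE n : pow_gauge p 0 n (fun i => if a i then `|w i| else 0) =
      \sum_(0 <= i < n) F a i.
    apply: eq_bigr => i _; rewrite /F.
    by case: ifP => _; rewrite ?wE// powR0// lt0r_neq0.
  by split=> -[M MP]; exists M => n; have := MP n; rewrite sumE.
have Rsep : separable R^o.
  exists (range ratr); last exact: dense_rat.
  exact: card_le_trans (card_image_le _ _) (countableP _).
(* With [tau] the identity, [n t] has color [t] and weight [1/(t+1)]. *)
have [] := @block_estimates R R^o theta Rsep _ (@sup_gauge R) 1 (sup_gaugeP R) _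
    color id (fun t => 2^-1 ^+ t) color_infinite.
- move=> j q e.
  exact: (@borel_fun_coordinate_baire R X R^o (fun i b => if b then w i else 0)).
- move=> m b x e bm e0; apply: sup_gauge_tail => //; apply/thP/EF.
  exists (\sum_(0 <= i < m) F b i) => n; have [nm|/ltnW mn] := leqP n m.
    exact: sum_nat_mono.
  have tail0 : \sum_(m <= i < n) F b i = 0.
    by rewrite big_nat big1// => i /andP[mi _]; rewrite /F bm.
  by rewrite (@big_cat_nat _ _ _ m 0 n)//= tail0 addr0.
- by move=> t; rewrite exprn_gt0// invr_gt0.
move=> x0 [n [k [c [n_lt n_color k0 k_lt est]]]].
have redP a : (exists M, forall n, \sum_(0 <= i < n) F a i <= M) <->
    RN_mod_c0 R (theta x0) (theta (flip x0 a)) by rewrite -thP EF.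
have k_ge := increasing_ge k_lt; have n_ge := increasing_ge n_lt.
(* If [c] tends to 0, flipping every [n t] preserves the image class although the harmonic series
   diverges. *)
have [csmall|] := pselect (forall e, 0 < e ->
    exists T, forall t, (T <= t)%N -> c t <= e).
  pose a i : bool := `[< exists t, i = n t >].
  have an i : a i -> exists t, i = n t by move/asboolP.
  have : RN_mod_c0 R (theta x0) (theta (flip x0 a)).
    apply: (sup_gauge_blocks k0 k_lt) => e e0.
    have e40 : 0 < e / 4 by rewrite divr_gt0.
    have [T1 T1P] := csmall _ e40; have [T2 T2P] := half_pow_lt e40.
    exists (maxn T1 T2) => t; rewrite geq_max => /andP[/T1P ct /T2P et].
    have [+ _] := est a an t; have -> : a (n t) by apply/asboolP; exists t.
    by move: ct et; set q := 2^-1 ^+ t; lra.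
  move=> /redP[M MP]; have [T] := harmonic_unbounded M; apply/negP; rewrite -leNgt.
  apply: le_trans (MP (n T)); apply: le_trans (sum_subsequence_le T n_lt (F0 a)).
  apply: ler_sum => t _; rewrite /F /h n_color.
  by have -> : a (n t) by apply/asboolP; exists t.
move=> /existsNP[e /not_implyP[e0 big]].
(* Otherwise [c] exceeds [e] infinitely often; indices at least [2 ^ l] have weights at most
   [2 ^- l], hence summable. *)
have /choice[f fP] l : exists t, (2 ^ l <= t)%N /\ e < c t.
  apply: contrapT => H; apply: big; exists (2 ^ l)%N => t lt_.
  by rewrite leNgt; apply/negP => ect; apply: H; exists t.
pose a i : bool := `[< exists l, i = n (f l) >].
have an i : a i -> exists t, i = n t by move/asboolP => [l ->]; exists (f l).
have : RN_mod_c0 R (theta x0) (theta (flip x0 a)).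
  apply/redP; exists 2 => K.
  apply: le_trans (half_pow_sum_le R K).
  (* [f] may repeat values, so the sum over selected positions is dominated by a double sum over
     positions and indices. *)
  apply: (@le_trans _ _ (\sum_(0 <= i < K) \sum_(0 <= l < K)
      (if i == n (f l) then 2^-1 ^+ l else 0))).
    rewrite !big_nat; apply: ler_sum => i /andP[_ iK]; rewrite /F.
    have pos l : 0 <= (if i == n (f l) then 2^-1 ^+ l else 0) :> R.
      by case: ifP => // _; rewrite exprn_ge0// invr_ge0.
    case: ifPn => [/asboolP[l il]|_]; last by rewrite sumr_ge0.
    have fl := (fP l).1.
    have lK : (l < K)%N.
      apply: leq_ltn_trans iK; rewrite il (leq_trans _ (n_ge _))//.
      by rewrite (leq_trans _ fl)// ltnW// ltn_expl.
    rewrite (bigD1_seq l)/= ?mem_index_iota ?iota_uniq//.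
    rewrite -il eqxx; apply: ler_wpDr; first by rewrite sumr_ge0.
    rewrite /h il n_color exprVn lef_pV2 ?posrE ?exprn_gt0// -natrX ler_nat.
    exact: leqW.
  rewrite exchange_big_nat/=; apply: ler_sum => l _.
  have q0 : 0 <= 2^-1 ^+ l :> R by rewrite exprn_ge0// invr_ge0.
  have [nK|Kn] := ltnP (n (f l)) K.
    rewrite (bigD1_seq (n (f l)))/= ?mem_index_iota ?iota_uniq//.
    by rewrite eqxx big1 ?addr0// => i /negbTE ->.
  rewrite big_nat big1// => i /andP[_ iK]; case: eqP => // ii.
  by move: iK; rewrite ii ltnNge Kn.
(* The block and error bounds give [c (f l) <= e/4 + 2 * (e/4)], contradicting [e < c (f l)]. *)
move=> sim; have e40 : 0 < e / 4 by rewrite divr_gt0.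
have [k1 k1P] := sup_gauge_tail sim e40; have [T TP] := half_pow_lt e40.
pose l := maxn k1 T.
have [fl ecf] := fP l.
have lfl : (l <= f l)%N by rewrite (leq_trans _ fl)// ltnW// ltn_expl.
have [_] := est a an (f l).
have -> : a (n (f l)) by apply/asboolP; exists l.
move=> /(_ isT).
have := TP (f l) (leq_trans (leq_maxr _ _) lfl).
have : sup_gauge (k (f l)) (k (f l).+1)
    (dist (theta x0) (theta (flip x0 a))) <= e / 4.
  apply: le_trans (k1P (k (f l).+1)); apply: (gauge_mono (sup_gaugeP R)) => //.
  by rewrite (leq_trans _ (k_ge _))// (leq_trans _ lfl)// leq_maxl.
by move: ecf; set q := 2^-1 ^+ (f l); lra.
Qed.

(** Distinct colors select disjoint sets of indices, so the [L] lower bounds add up. *)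
Lemma fiber_sum_ge (R : realType) (c : nat -> R) (K : nat -> nat) L T :
  (forall l, (l < L)%N -> 1 <= \sum_(0 <= t < K l | color t == l) c t) ->
  (forall l, (l < L)%N -> (K l <= T)%N) ->
  L%:R <= \sum_(0 <= t < T | (color t < L)%N && (t < K (color t))%N) c t.
Proof.
elim: L => [_ _|L IH c1 KT]; first by rewrite big_pred0_eq.
rewrite (bigID (fun t => color t == L))/= -natr1 addrC lerD//; last first.
  rewrite (le_trans (c1 L _))// (big_nat_widen 0 (K L) T) ?KT//=.
  rewrite le_eqVlt; apply/orP; left; apply/eqP; apply: eq_bigl => t.
  by case: eqP => [->|]; rewrite ?ltnS ?leqnn ?andbT ?andbF.
apply: (le_trans (IH _ _)) => [l lL|l lL|]; [exact/c1/ltnW|exact/KT/ltnW|].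
rewrite le_eqVlt; apply/orP; left; apply/eqP; apply: eq_bigl => t.
rewrite ltnS [(color t <= L)%N]leq_eqVlt.
by case: eqP => [->|]; rewrite ?ltnn ?andbT ?andbF.
Qed.

Lemma RN_mod_c0_not_reducible (R : realType) (X : normedModType R) (p : R) :
  separable X -> 0 < p -> ~ borel_reducible (RN_mod_c0 R) (E_pow X p).
Proof.
move=> Xsep p0 [th bth thP].
pose h i : R^o := (color i).+1%:R^-1.
have h0 i : 0 <= h i by rewrite invr_ge0.
pose iota : (nat -> bool) -> {ptws nat -> R} := flip_seq h.
pose theta x := th (iota x).
have RNP x a : RN_mod_c0 R (iota x) (iota (flip x a)) <->
    forall e, 0 < e -> exists N, forall i, (N <= i)%N -> a i -> h i <= e.
  have distE i : `|iota x i - iota (flip x a) i| = if a i then h i else 0.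
    have /(congr1 (fun f => f i)) := dist_flip_seq h x a.
    by rewrite /dist (ger0_norm (h0 i)).
  split=> [/cvgrPdist_le lim e e0|lim].
    have [N _ NP] := lim e e0; exists N => i /NP.
    by rewrite /= sub0r normrN distE => + ai; rewrite ai.
  apply/cvgrPdist_le => e e0; have [N NP] := lim e e0.
  exists N => // i /= /NP; rewrite sub0r normrN distE.
  by case: ifP => [_ ->//|_ _]; exact: ltW.
have Dgauge := pow_gaugeP p0.
set C := 2 `^ p in Dgauge.
have C0 : 0 < C := gauge_const_gt0 Dgauge.
(* Taking [tau] to be [color] itself makes every color occur at infinitely many [n t]. *)
have [] := @block_estimates R X theta Xsep _ (pow_gauge p) C Dgauge _
    color color (fun t => 2^-1 ^+ t) color_infinite.
- move=> j q e.
  exact: (@borel_fun_coordinate_baire R R^o X (fun i b => if b then h i else 0)).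
- move=> m b x e bm e0; apply: pow_gauge_tail => //; apply/thP/RNP => e' _.
  by exists m => i mi; rewrite bm.
- by move=> t; rewrite exprn_gt0// invr_gt0.
move=> x0 [n [k [c [n_lt n_color k0 k_lt est]]]].
have redP a : RN_mod_c0 R (iota x0) (iota (flip x0 a)) <->
    E_pow X p (theta x0) (theta (flip x0 a)) by exact: thP.
have k_ge := increasing_ge k_lt; have n_ge := increasing_ge n_lt.
have n_inj : injective n.
  move=> t u ntu; case: (ltngtP t u) => // /(increasing_mono n_lt);
  by rewrite ntu ltnn.
pose d a := dist (theta x0) (theta (flip x0 a)).
have D0 i j a : 0 <= pow_gauge p i j (d a).
  by rewrite sumr_ge0// => ? _; exact: powR_ge0.
have eta_sum T : \sum_(0 <= t < T) (2 * C * 2^-1 ^+ t) <= 2 * C * 2.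
  by rewrite -mulr_sumr ler_wpM2l ?half_pow_sum_le// mulr_ge0 ?ltW.
(* Otherwise flipping all [n t] of color [l] keeps the image class, while the source changes by the
   constant [1/(l+1)] infinitely often. *)
have fibers l : exists K, 1 <= \sum_(0 <= t < K | color t == l) c t.
  apply: contrapT => noK.
  pose a i : bool := `[< exists2 t, i = n t & color t = l >].
  have an i : a i -> exists t, i = n t by move=> /asboolP[t ->]; exists t.
  have antE t : a (n t) = (color t == l).
    apply/asboolP/eqP => [[u /n_inj -> //]|tl]; by exists t.
  have : E_pow X p (theta x0) (theta (flip x0 a)).
    apply/E_powP; exists (C * (1 + 2 * C * 2)) => N.
    apply: (@le_trans _ _ (pow_gauge p 0 (k N) (d a))).
      by apply: sum_nat_mono => // j; exact: powR_ge0.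
    rewrite -pow_gauge_blocks//.
    apply: (@le_trans _ _ (\sum_(0 <= t < N)
        C * ((if color t == l then c t else 0) + 2 * C * 2^-1 ^+ t))).
      by apply: ler_sum => t _; have [+ _] := est a an t; rewrite antE.
    rewrite -mulr_sumr ler_pM2l// big_split/= lerD// -big_mkcond/=.
    by rewrite leNgt; apply/negP => /ltW ?; apply: noK; exists N.
  move=> /redP/RNP/(_ (l.+2%:R^-1))[|N NP]; first by rewrite invr_gt0.
  have [t Nt tl] := color_infinite l N.
  have := NP (n t) (leq_trans Nt (n_ge t)); rewrite antE tl eqxx => /(_ isT).
  by rewrite /h n_color tl lef_pV2 ?posrE// ler_nat ltnn.
have [K KP] := choice fibers.
pose a i : bool := `[< exists2 t, i = n t & (t < K (color t))%N >].
have an i : a i -> exists t, i = n t by move=> /asboolP[t ->]; exists t.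
have antE t : a (n t) = (t < K (color t))%N.
  apply/asboolP/idP => [[u /n_inj -> //]|tl]; by exists t.
have : RN_mod_c0 R (iota x0) (iota (flip x0 a)).
  (* Colors from [M] on have weight below [e]; each smaller color is flipped only finitely often. *)
  apply/RNP => e e0; pose M := Num.bound e^-1.
  exists (n (\max_(l < M) K l)) => i ni /asboolP[t it tK].
  have [tM|Mt] := ltnP (color t) M.
    move: ni; rewrite it leqNgt; case/negP; apply: increasing_mono => //.
    apply: (leq_trans tK); exact: (leq_bigmax (Ordinal tM)).
  rewrite /h it n_color -[e]invrK lef_pV2 ?posrE ?invr_gt0//.
  apply: ltW; apply: (lt_le_trans (archi_boundP _)).
    by rewrite invr_ge0 ltW.
  by rewrite ler_nat leqW.
move=> /redP/E_powP[B BP].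
(* Summing the lower block estimates bounds the selected [c t] by [C * (B + 2 * C * 2)], yet [L]
   colors contribute at least [L]. *)
pose L := Num.bound (C * (B + 2 * C * 2)).
have B0 : 0 <= B by exact: le_trans (D0 0 0 a)%N (BP _).
have := fiber_sum_ge (fun l (_ : (l < L)%N) => KP l)
  (fun l lL => leq_bigmax (Ordinal lL) : (K l <= \max_(l < L) K l)%N).
set T := \max_(l < L) K l.
move=> LT.
have : C * (B + 2 * C * 2) < L%:R.
  have K0 : 0 <= 2 * C * 2 by rewrite !mulr_ge0// ltW.
  by apply: archi_boundP; rewrite mulr_ge0 ?addr_ge0//; exact: ltW.
apply/negP; rewrite -leNgt; apply: (le_trans LT).
apply: (@le_trans _ _ (\sum_(0 <= t < T) C *
    (pow_gauge p (k t) (k t.+1) (d a) + 2 * C * 2^-1 ^+ t))).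
  rewrite big_mkcond/=; apply: ler_sum => t _; case: ifP => [/andP[_ tK]|_].
    by have [_] := est a an t; rewrite antE; apply.
  have q0 : 0 <= 2 * C * 2^-1 ^+ t by rewrite !mulr_ge0 ?exprn_ge0// ltW.
  by rewrite mulr_ge0 ?addr_ge0//; exact: ltW.
by rewrite -mulr_sumr ler_pM2l// big_split/= lerD// pow_gauge_blocks.
Qed.

(** * Reducibility *)

Lemma continuous_borel_fun (T U : topologicalType) (f : T -> U) :
  continuous f -> borel_fun f.
Proof.
move=> cf; apply: smallest_sub => [|B oB]; last first.
  by apply: sub_gen_smallest; apply: open_comp => // x _; exact: cf.
have [s0 sC sU] := smallest_sigma_algebra setT (@open T).
split=> [|A sA|A sA]; rewrite /=.
- by rewrite preimage_set0.
- by rewrite setTD preimage_setC -setTD; exact: sC.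
- by rewrite preimage_bigcup; exact: sU.
Qed.

Lemma continuous_ptws (T : topologicalType) (Y : uniformType)
    (f : T -> {ptws nat -> Y}) :
  (forall i, continuous (fun x => f x i)) -> continuous f.
Proof. by move=> cf x; apply/pointwise_cvgP => i; exact: cf. Qed.

Lemma continuous_coordinate (Y : uniformType) (i : nat) :
  continuous (fun u : {ptws nat -> Y} => u i).
Proof.
move=> u.
by have /pointwise_cvgP/(_ i) : {ptws, nbhs (u : {ptws nat -> Y}) --> u} by [].
Qed.

Lemma RN_mod_c0_reducible (R : realType) (X : normedModType R) (v : X) :
  v != 0 -> borel_reducible (RN_mod_c0 R) (E_zero X).
Proof.
move=> v0; have nv0 : 0 < `|v| by rewrite normr_gt0.
exists (fun x i => x i *: v) => [|x y].
  apply: continuous_borel_fun; apply: continuous_ptws => i x.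
  exact: (@cvg_comp _ _ _ (fun u : {ptws nat -> R} => u i) (fun r : R => r *: v)
    _ _ _ (@continuous_coordinate R i x) (@scalel_continuous _ _ v (x i))).
have normE i : `|x i *: v - y i *: v| = `|x i - y i| * `|v|.
  by rewrite -scalerBl normrZ.
split=> /cvgrPdist_le lim; apply/cvgrPdist_le => e e0.
  have [N _ NP] := lim _ (divr_gt0 e0 nv0); exists N => // i /NP /=.
  by rewrite !sub0r !normrN normE normrM normr_id ler_pdivlMr// normr_id.
have [N _ NP] := lim _ (mulr_gt0 e0 nv0); exists N => // i /NP /=.
by rewrite !sub0r !normrN normE normrM !normr_id ler_pM2r.
Qed.

(** * Bump functions at a fixed scale *)

Section bump.
Variables (R : realType) (X : normedModType R) (q : nat -> X).
Hypothesis qdense : forall y e, 0 < e -> exists i, `|y - q i| < e.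

(** The default [3 * u] caps the minimum, which yields the bound [2 * u] and covers the empty
    minimum at [k = 0]. *)
Definition bump (u : R) (k : nat) (x : X) : R :=
  Num.max 0 (Num.min (\big[Num.min/3 * u]_(0 <= j < k) `|x - q j| - u)
                     (3 * u - `|x - q k|)).

Lemma min_lipschitz (a b c d r : R) : `|a - c| <= r -> `|b - d| <= r ->
  `|Num.min a b - Num.min c d| <= r.
Proof.
rewrite !ler_norml => /andP[? ?] /andP[? ?].
by case: (leP a b); case: (leP c d) => ? ?; apply/andP; split; lra.
Qed.

Lemma bump_lipschitz u k x y : `|bump u k x - bump u k y| <= `|x - y|.
Proof.
have dist_lip j : `| `|x - q j| - `|y - q j| | <= `|x - y|.
  by rewrite (le_trans (ler_dist_dist _ _))// opprB addrA subrK.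
have min_lip : `|\big[Num.min/3 * u]_(0 <= j < k) `|x - q j| -
    \big[Num.min/3 * u]_(0 <= j < k) `|y - q j| | <= `|x - y|.
  apply: (big_ind2 (fun a b => `|a - b| <= `|x - y|)) => //.
    by rewrite subrr normr0.
  by move=> *; exact: min_lipschitz.
have := @min_lipschitz (\big[Num.min/3 * u]_(0 <= j < k) `|x - q j| - u)
  (3 * u - `|x - q k|) (\big[Num.min/3 * u]_(0 <= j < k) `|y - q j| - u)
  (3 * u - `|y - q k|) `|x - y|.
rewrite /bump; set A := Num.min _ _; set B := Num.min _ _ => minAB.
have {minAB} : `|A - B| <= `|x - y|.
  apply: minAB; rewrite !opprD !opprK.
    by rewrite addrACA addNr addr0.
  by rewrite addrACA subrr add0r addrC distrC dist_lip.
have := normr_ge0 (x - y); move: (`|x - y|) => r r0.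
rewrite !ler_norml => /andP[? ?].
by case: (leP 0 A); case: (leP 0 B) => ? ?; apply/andP; split; lra.
Qed.

Lemma bump_bounds u k x : 0 <= u -> 0 <= bump u k x <= 2 * u.
Proof.
move=> u0; rewrite /bump le_max lexx ge_max ge_min mulr_ge0//=.
have := bigmin_le_id (index_iota 0 k) (3 * u) xpredT (fun j => `|x - q j|).
by move=> h; apply/orP; left; move: h; lra.
Qed.

Lemma bump_finite u x : 0 < u -> exists K, forall k, (K <= k)%N -> bump u k x = 0.
Proof.
move=> u0; have [i xi] := qdense x u0; exists i.+1 => k ik.
rewrite /bump; apply/max_idPl; rewrite ge_min subr_le0; apply/orP; left.
apply: (le_trans _ (ltW xi)); apply: ge_bigmin_seq => //.
by rewrite mem_index_iota.
Qed.

Lemma bump_separates u x y : 0 < u -> 5 * u <= `|x - y| ->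
  exists k, u <= `|bump u k x - bump u k y|.
Proof.
move=> u0 xy.
have u20 : 0 < 2 * u by rewrite mulr_gt0.
have ex : exists i, `|x - q i| < 2 * u by exact: qdense.
(* By minimality the earlier [q j] are at distance at least [2 * u] from [x], so the bump is at
   least [u] there; [q k] is more than [3 * u] away from [y], where it vanishes. *)
case: (ex_minnP ex) => k xk kmin; exists k.
have -> : bump u k y = 0.
  apply/max_idPl; rewrite ge_min; apply/orP; right.
  have := ler_distD (q k) x y; rewrite [`|q k - y|]distrC.
  by move: xk xy; lra.
rewrite subr0 ger0_norm; last by have /andP[] := bump_bounds k x (ltW u0).
rewrite /bump le_max le_min; apply/orP; right; apply/andP; split.
  have : 2 * u <= \big[Num.min/3 * u]_(0 <= j < k) `|x - q j|.
    rewrite big_nat_cond; apply: le_bigmin => [|j]; first by move: u0; lra.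
    rewrite andbT => /andP[_ jk]; rewrite leNgt; apply/negP => /kmin.
    by rewrite leqNgt jk.
  by lra.
by move: xk; lra.
Qed.

End bump.

Lemma E_zero_reducible (R : realType) (X : normedModType R) :
  separable X -> borel_reducible (E_zero X) (RN_mod_c0 R).
Proof.
move=> /separable_dense_seq[q qd].
pose T := (nat * nat * nat)%type.
pose f (t : T) := bump q (2^-1 ^+ t.1.2) t.2.
(* A triple codes a coordinate, a scale and a bump index; numbers coding no triple give 0. *)
pose theta (x : {ptws nat -> X}) : {ptws nat -> R} :=
  fun i => if pickle_inv i is Some t then f t (x t.1.1) else 0.
have half_gt0 m : 0 < 2^-1 ^+ m :> R by rewrite exprn_gt0// invr_gt0.
exists theta => [|x y].
  apply: continuous_borel_fun.
  apply: (@continuous_ptws {ptws nat -> X} R) => i.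
  case it : (@pickle_inv T i) => [t|].
    have cf : continuous (f t).
      move=> z; apply/cvgrPdist_lt => e e0.
      apply: filterS (nbhsx_ballx z e e0) => w; rewrite -ball_normE.
      exact: le_lt_trans (bump_lipschitz _ _ _ _ _).
    have -> : (fun x => theta x i) = (fun x => f t (x t.1.1)).
      by apply/funext => x; rewrite /theta it.
    move=> x.
    exact: (@cvg_comp _ _ _ (fun u : {ptws nat -> X} => u t.1.1) (f t) _ _ _
      (@continuous_coordinate X t.1.1 x) (cf (x t.1.1))).
  have -> : (fun x => theta x i) = (fun=> 0).
    by apply/funext => x; rewrite /theta it.
  exact: (@cst_continuous {ptws nat -> X} R 0).
split=> /cvgrPdist_lt lim; apply/cvgrPdist_lt => e e0.
  have [N _ NP] := lim e e0.
  have [M MP] := half_pow_lt (divr_gt0 e0 (ltr0n R 2)).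
  have fin (nm : nat * nat) : exists K, forall k, (K <= k)%N ->
      f (nm, k) (x nm.1) = 0 /\ f (nm, k) (y nm.1) = 0.
    have [K1 K1P] := bump_finite qd (x nm.1) (half_gt0 nm.2).
    have [K2 K2P] := bump_finite qd (y nm.1) (half_gt0 nm.2).
    exists (maxn K1 K2) => k; rewrite geq_max => /andP[? ?].
    by split; [exact: K1P|exact: K2P].
  have [K KP] := choice fin.
  (* Beyond [I] the difference is below [e]: by the Lipschitz bound if [n >= N], by the size of the
     bumps if [m >= M], and because both bumps vanish otherwise. *)
  pose I := \max_(n < N) \max_(m < M) \max_(k < K (nat_of_ord n, nat_of_ord m))
    (pickle (nat_of_ord n, nat_of_ord m, nat_of_ord k)).+1.
  exists I => // i /= Ii; rewrite sub0r normrN /theta.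
  case: (pickle_inv i) (pickle_invK (T := T) i) => [[[n m] k]|] /= ip;
    last by rewrite subrr normr0.
  have [nN|Nn] := ltnP n N; last first.
    rewrite (le_lt_trans (bump_lipschitz _ _ _ _ _))//.
    by have := NP n Nn; rewrite /= sub0r normrN normr_id.
  have [mM|Mm] := ltnP m M; last first.
    have /andP[? ?] := bump_bounds q k (x n) (ltW (half_gt0 m)).
    have /andP[? ?] := bump_bounds q k (y n) (ltW (half_gt0 m)).
    have := MP m Mm; rewrite ltr_norml /f /= => ?.
    by apply/andP; split; lra.
  have [kK|Kk] := ltnP k (K (n, m)); last first.
    by have [-> ->] := KP (n, m) k Kk; rewrite subrr normr0.
  exfalso; move: Ii; rewrite leqNgt => /negP; apply.
  rewrite -ip /I.
  apply: leq_trans (leq_bigmax (Ordinal nN)) => /=.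
  apply: leq_trans (leq_bigmax (Ordinal mM)) => /=.
  exact: leq_trans (leq_bigmax (Ordinal kK)).
have [m mP] := half_pow_lt (divr_gt0 e0 (ltr0n R 5)).
have [I _ IP] := lim _ (half_gt0 m).
(* For [n >= N] every triple with first entry [n] has a code at least [I], including that of a bump
   separating [x n] from [y n]. *)
pose N := \max_(i < I) (if pickle_inv i is Some t then (t : T).1.1.+1 else 0%N).
exists N => // n /= Nn; rewrite sub0r normrN normr_id ltNge; apply/negP => exy.
have [|k] := bump_separates qd (half_gt0 m) (x := x n) (y := y n).
  by apply: le_trans exy; have := mP m (leqnn m); lra.
apply/negP; rewrite -ltNge.
have nI : (I <= pickle ((n, m, k) : T))%N.
  rewrite leqNgt; apply/negP => pI; have : (N < n.+1)%N by [].
  rewrite ltnNge => /negP; apply.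
  apply: leq_trans (leq_bigmax (Ordinal pI)) => /=.
  by rewrite pickleK_inv.
by have := IP _ nI; rewrite /= sub0r normrN /theta pickleK_inv.
Qed.

Theorem theorem1p5 (R : realType) (X : completeNormedModType R)
    (Xsep : separable X) (Xnontrivial : exists v : X, v != 0)
    (p : R) (p_ge1 : 1 <= p) :
  borel_bireducible (E_zero X) (RN_mod_c0 R) /\
  ~ borel_reducible (E_pow X p) (RN_mod_c0 R) /\
  ~ borel_reducible (RN_mod_c0 R) (E_pow X p).
Proof.
have [v v0] := Xnontrivial.
have p0 : 0 < p by exact: lt_le_trans p_ge1.
split; first by split; [exact: E_zero_reducible|exact: RN_mod_c0_reducible v0].
by split; [exact: E_pow_not_reducible v0 p0|exact: RN_mod_c0_not_reducible].
Qed.
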